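(* Let $L$ be the Hilbert-style axiomatic system for STIT imagination logic given by axioms (A0)–(A5) and rules (R1)–(R3) listed in the context, and let $\Theta$ be an $L$-consistent set of sentences. Then $\Theta$ has a model; that is, there exist an imagination model $\mathcal{M} = \langle Tree, \leq, Ag, Choice, \{N_a \mid a\in Ag\}, V\rangle$, a moment $m\in Tree$ and a history $h$ of $\mathcal{M}$ passing through $m$ such that $\mathcal{M}, m/h \vDash A$ for every $A\in\Theta$.
   Context: **Language.** Fix a finite set $Ag$ of agents (distinct agent indices stand for distinct agents) and a countably infinite set $Var$ of propositional variables. Sentences are built from $Var$ by the Boolean connectives ($\neg,\wedge$ primitive, others defined as usual) and the unary modalities $S$ (''settled true''), $[c]_a$ (''agent $a$ cstit-realizes'') and $I_a$ (''agent $a$ imagines that'') for each $a\in Ag$. $PA$ abbreviates $\neg S\neg A$. **The system $L$.** Axioms: (A0) propositional tautologies; (A1) $S$ is an S5 modality (i.e. the S5 axioms for $S$); (A2) for every $a\in Ag$, $[c]_a$ is an S5 modality; (A3) $SA \to [c]_aA$ for every $a\in Ag$; (A4) $(P[c]_{a_1}A_1\wedge\ldots\wedge P[c]_{a_n}A_n)\to P([c]_{a_1}A_1\wedge\ldots\wedge[c]_{a_n}A_n)$, provided $a_1,\ldots,a_n$ are pairwise different; (A5) $I_aA\to([c]_aI_aA\wedge\neg SI_aA)$ for every $a\in Ag$. Rules: (R1) modus ponens; (R2) from $A$ infer $SA$; (R3) from $A\leftrightarrow B$ infer $I_aA\leftrightarrow I_aB$, for every $a\in Ag$. (As usual, (R2)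 and (R3) are applied to theorems of $L$.) A set $\Theta$ of sentences is $L$-consistent iff there are no $A_1,\ldots,A_n\in\Theta$ such that $\neg(A_1\wedge\ldots\wedge A_n)$ is a theorem of $L$. **Imagination models.** An imagination model is a tuple $\mathcal{M}=\langle Tree,\leq,Ag,Choice,\{N_a\mid a\in Ag\},V\rangle$ where: - $Tree$ is a non-empty set (of moments) and $\leq$ is a partial order on $Tree$ such that $\forall m_1,m_2\,\exists m\,(m\leq m_1\wedge m\leq m_2)$ and $\forall m_1,m_2,m\,((m_1\leq m\wedge m_2\leq m)\to(m_1\leq m_2\vee m_2\leq m_1))$. - A history of $\mathcal{M}$ is a maximal $\leq$-chain in $Tree$; $h$ passes through $m$ iff $m\in h$; $H_m$ is the set of histories passing through $m$. - $Ag$ is the finite set of agents, disjoint from all the other items in $\mathcal{M}$. - $Choice$ assigns to each $m\in Tree$ and $a\in Ag$ a partition $Choice^m_a$ of $H_m$; for $h\in H_m$, $Choice^m_a(h)$ is the cell containing $h$. Two conditions hold: (i) no choice between undivided histories: for all $m\in Tree$, $a\in Ag$, $e\in Choice^m_a$, $h,h'\in H_m$, if $h\in e$ and there is $m'$ with $m<m'$ and $m'\in h\cap h'$, then $h'\in e$; (ii) independence of agents: for every $m\in Tree$ and every function $f$ on $Ag$ with $f(a)\in Choice^m_a$ for all $a\in Ag$, $\bigcap_{a\in Ag}f(a)\neq\emptyset$. - $MH(\mathcal{M})=\{\langle m,h\rangle\mid m\in Tree,\ h\in H_m\}$; its elements are written $m/h$. - For each $a\in Ag$, $N_a: MH(\mathcal{M})\to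 2^{(2^{MH(\mathcal{M})})}$ is a neighborhood function. - $V: Var\to 2^{MH(\mathcal{M})}$. **Satisfaction.** Write $\|A\|=\{x\in MH(\mathcal{M})\mid\mathcal{M},x\vDash A\}$. Then: $\mathcal{M},m/h\vDash p$ iff $m/h\in V(p)$, for $p\in Var$; Boolean connectives are classical; $\mathcal{M},m/h\vDash SA$ iff $\mathcal{M},m/h'\vDash A$ for all $h'\in H_m$; $\mathcal{M},m/h\vDash[c]_aA$ iff $\mathcal{M},m/h'\vDash A$ for all $h'\in Choice^m_a(h)$; $\mathcal{M},m/h\vDash I_aA$ iff $\|A\|\in N_a(m/h')$ for all $h'\in Choice^m_a(h)$, and there is $h''\in H_m$ with $\|A\|\notin N_a(m/h'')$. *)

(* Defs.v *)
From mathcomp Require Import all_boot.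
From mathcomp Require Import boolp classical_sets functions cardinality.
From Stdlib Require List.

Set Implicit Arguments.
Unset Strict Implicit.
Unset Printing Implicit Defensive.

Local Open Scope classical_set_scope.

Section Language.
Variables (Ag : finType) (Var : Type).

Inductive sentence : Type :=
| Atom of Var
| Neg of sentence
| And of sentence & sentence
| Settled of sentence
| Cstit of Ag & sentence
| Imag of Ag & sentence.

Definition Imp A B := Neg (And A (Neg B)).
Definition Iff A B := And (Imp A B) (Imp B A).
Definition Poss A := Neg (Settled (Neg A)).

(* Conjunction of the nonempty list A :: s. *)
Fixpoint conj_from (A : sentence) (s : seq sentence) : sentence :=
  if s is B :: s' then And A (conj_from B s') else A.

(* Boolean evaluation in which atoms and modal sentences are independent
   propositional letters, valued by v. *)
Fixpoint beval (v : sentence -> bool) (A : sentence) : bool :=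
  match A with
  | Neg B => ~~ beval v B
  | And B C => beval v B && beval v C
  | _ => v A
  end.

Definition tautology A := forall v, beval v A.

Inductive S5_axiom (Box : sentence -> sentence) : sentence -> Prop :=
| S5_K A B : S5_axiom Box (Imp (Box (Imp A B)) (Imp (Box A) (Box B)))
| S5_T A : S5_axiom Box (Imp (Box A) A)
| S5_4 A : S5_axiom Box (Imp (Box A) (Box (Box A)))
| S5_5 A : S5_axiom Box (Imp (Neg (Box A)) (Box (Neg (Box A)))).

Definition cstit_pair (x : Ag * sentence) := Cstit x.1 x.2.

(* Necessitation for Cstit a is derivable, from L_A3 and L_R2. *)
Inductive theoremL : sentence -> Prop :=
| L_A0 A : tautology A -> theoremL A
| L_A1 A : S5_axiom Settled A -> theoremL A
| L_A2 a A : S5_axiom (Cstit a) A -> theoremL A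
| L_A3 a A : theoremL (Imp (Settled A) (Cstit a A))
| L_A4 (x : Ag * sentence) (s : seq (Ag * sentence)) :
    uniq [seq y.1 | y <- x :: s] ->
    theoremL (Imp (conj_from (Poss (cstit_pair x))
                             [seq Poss (cstit_pair y) | y <- s])
                  (Poss (conj_from (cstit_pair x)
                                   [seq cstit_pair y | y <- s])))
| L_A5 a A :
    theoremL (Imp (Imag a A)
                  (And (Cstit a (Imag a A)) (Neg (Settled (Imag a A)))))
| L_R1 A B : theoremL A -> theoremL (Imp A B) -> theoremL B
| L_R2 A : theoremL A -> theoremL (Settled A)
| L_R3 a A B : theoremL (Iff A B) -> theoremL (Iff (Imag a A) (Imag a B)).

Definition L_consistent (Theta : set sentence) : Prop :=
  ~ exists (A : sentence) (s : seq sentence),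
      List.Forall Theta (A :: s) /\ theoremL (Neg (conj_from A s)).

End Language.

Section Histories.
Variables (T : Type) (le : T -> T -> Prop).

Definition history (h : set T) : Prop :=
  total_on h le /\ forall h', total_on h' le -> h `<=` h' -> h' = h.

Definition histories_at (m : T) : set (set T) := [set h | history h /\ h m].

Record moment_history := MomentHistory {
  mh_moment : T;
  mh_history : set T;
  mh_passes : histories_at mh_moment mh_history
}.

End Histories.

(* Agents and moments are elements of different types, so the requirement that
   Ag be disjoint from the other items of the model has no counterpart here. *)
Record imagination_model (Ag : finType) (Var : Type) := ImaginationModel {
  Tree :> Type;
  tree_le : Tree -> Tree -> Prop;
  tree_nonempty : [set: Tree] !=set0;
  tree_refl : forall m, tree_le m m;
  tree_antisym : forall m1 m2, tree_le m1 m2 -> tree_le m2 m1 -> m1 = m2;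
  tree_trans : forall m1 m2 m3,
    tree_le m1 m2 -> tree_le m2 m3 -> tree_le m1 m3;
  tree_connected : forall m1 m2, exists m, tree_le m m1 /\ tree_le m m2;
  tree_no_backward_branching : forall m1 m2 m,
    tree_le m1 m -> tree_le m2 m -> tree_le m1 m2 \/ tree_le m2 m1;
  Choice : Tree -> Ag -> set (set (set Tree));
  Choice_partition : forall m a,
    partition (Choice m a) id (histories_at tree_le m);
  Choice_undivided : forall m a e h h',
    Choice m a e -> histories_at tree_le m h -> histories_at tree_le m h' ->
    e h ->
    (exists m', (tree_le m m' /\ m <> m') /\ (h `&` h') m') ->
    e h';
  Choice_independent : forall m (f : Ag -> set (set Tree)),
    (forall a, Choice m a (f a)) -> \bigcap_(a in [set: Ag]) f a !=set0;
  Nbhd : Ag -> moment_history tree_le -> set (set (moment_history tree_le));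
  Val : Var -> set (moment_history tree_le)
}.

Section Satisfaction.
Variables (Ag : finType) (Var : Type) (M : imagination_model Ag Var).

Definition MH := moment_history (@tree_le Ag Var M).

(* The union of the cells containing h; as Choice m a is a partition, this is
   the cell containing h whenever h passes through m. *)
Definition Choice_cell (m : M) (a : Ag) (h : set M) : set (set M) :=
  \bigcup_(e in [set e | Choice m a e /\ e h]) e.

(* sat A is the truth set of A. *)
Fixpoint sat (A : sentence Ag Var) : set MH :=
  match A with
  | Atom p => Val p
  | Neg B => [set x | ~ sat B x]
  | And B C => [set x | sat B x /\ sat C x]
  | Settled B => [set x |
      forall h' (mh' : histories_at (@tree_le _ _ M) (mh_moment x) h'),
        sat B (MomentHistory mh')]
  | Cstit a B => [set x |
      forall h' (mh' : histories_at (@tree_le _ _ M) (mh_moment x) h'),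
        Choice_cell (mh_moment x) a (mh_history x) h' ->
        sat B (MomentHistory mh')]
  | Imag a B => [set x |
      (forall h' (mh' : histories_at (@tree_le _ _ M) (mh_moment x) h'),
        Choice_cell (mh_moment x) a (mh_history x) h' ->
        Nbhd a (MomentHistory mh') (sat B))
      /\ exists h'' (mh'' : histories_at (@tree_le _ _ M) (mh_moment x) h''),
        ~ Nbhd a (MomentHistory mh'') (sat B)]
  end.

End Satisfaction.

(* Main.v *)
Require Import Defs.
From mathcomp Require Import all_boot.
From mathcomp Require Import boolp classical_sets functions cardinality.
From Stdlib Require List.

Set Implicit Arguments.
Unset Strict Implicit.
Unset Printing Implicit Defensive.

Local Open Scope classical_set_scope.
Local Open Scope card_scope.

(** The model is built from the maximal consistent sets, called worlds here.

    A world is a set of sentences that contains every theorem and respects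
    negation and conjunction; Zorn's lemma extends to a world any set from which
    some sentence is not derivable ([Lindenbaum]).  For an S5 operator, two
    worlds are canonically accessible from each other iff they contain the same
    boxed sentences, so the accessibility relations of [S] and of [[c]_a] are the
    kernels of the maps [moment_of] and [choice_of a].  By A3 the second
    refines the first, and A4 gives independence of agents: any choice of one
    [choice_of a] class per agent inside a [moment_of] class has a common world
    ([independence]).

    These data become a tree of height three: a root, above it one node per
    [moment_of] class, above each node one leaf per world of the class.  The
    histories through a node are then the branches to its worlds ([branch]), and
    since distinct branches through a node divide there, any partition of them
    respects undividedness.  The root and the leaves give every agent a single
    choice.

    All [moment_of] classes must occur in one tree because of the neighbourhood
    semantics of [I_a]: the neighbourhoods of a world are the sets
    [{u | A \in u}] with [I_a A] in that world, and one needs that [A] and [B]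
    have the same truth set only if [A <-> B] is a theorem, so that R3 makes
    membership of [I_a A] depend on the truth set of [A] alone
    ([imagined_truth_set]).  With the whole set of worlds present in the tree this
    is completeness for theorems.  The truth lemma ([truth]) then follows by
    induction; in the case of [I_a], the two conjuncts of its semantic clause are
    the two conjuncts provided by A5. *)

(** * Derivations and the Lindenbaum lemma *)

Section Derivations.
Variables (Ag : finType) (Var : Type).
Local Notation sentence := (sentence Ag Var).
Implicit Types (A B C : sentence) (G : set sentence).

(** Modus ponens is the only rule applicable to hypotheses: necessitation acts
    on theorems only, which is what makes the deduction theorem hold. *)
Inductive deriv G : sentence -> Prop :=
| deriv_hyp A : G A -> deriv G A
| deriv_thm A : theoremL A -> deriv G A
| deriv_mp A B : deriv G A -> deriv G (Imp A B) -> deriv G B.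

Lemma deriv_taut G A B : tautology (Imp A B) -> deriv G A -> deriv G B.
Proof. by move=> AB dA; apply: deriv_mp dA _; apply/deriv_thm/L_A0. Qed.

Lemma deriv_taut2 G A B C :
  tautology (Imp A (Imp B C)) -> deriv G A -> deriv G B -> deriv G C.
Proof. by move=> ABC dA dB; apply: deriv_mp dB _; exact: deriv_taut dA. Qed.

Lemma deriv_sub G G' A : G `<=` G' -> deriv G A -> deriv G' A.
Proof.
move=> GG'; elim=> {A} [A /GG' GA|A tA|A B _ dA _ dAB].
- exact: deriv_hyp.
- exact: deriv_thm.
- exact: deriv_mp dAB.
Qed.

Lemma deriv_set0 A : deriv set0 A -> theoremL A.
Proof. by elim=> {A} // A B _ dA _ dAB; exact: L_R1 dAB. Qed.

Lemma deduction G A B : deriv (A |` G) B -> deriv G (Imp A B).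
Proof.
elim=> {B} [B [->|GB]|B tB|B C _ dB _ dBC].
- by apply/deriv_thm/L_A0 => v /=; rewrite andbN.
- apply: deriv_taut (deriv_hyp GB) => v /=.
  by case: (beval v A); case: (beval v B).
- apply: deriv_taut (deriv_thm _ tB) => v /=.
  by case: (beval v A); case: (beval v B).
- apply: deriv_taut2 dB dBC => v /=.
  by case: (beval v A); case: (beval v B); case: (beval v C).
Qed.

Lemma beval_imps v A s :
  beval v (foldr (@Imp Ag Var) A s) = all (beval v) s ==> beval v A.
Proof.
elim: s => //= B s ->.
by case: (beval v B); case: (all _ s); case: (beval v A).
Qed.

Lemma beval_conj v A s : beval v (conj_from A s) = all (beval v) (A :: s).
Proof. by elim: s A => [|B s IHs] A /=; rewrite ?andbT ?IHs. Qed.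

Lemma deriv_finite G A : deriv G A ->
  exists s, List.Forall G s /\ theoremL (foldr (@Imp Ag Var) A s).
Proof.
elim=> {A} [A GA|A tA|A B _ [s [Gs sA]] _ [t [Gt tAB]]].
- exists [:: A]; split; first by repeat constructor.
  by apply: L_A0 => v /=; rewrite andbN.
- by exists [::]; split=> //; constructor.
- exists (s ++ t); split; first exact/List.Forall_app.
  apply: L_R1 tAB _; apply: L_R1 sA _; apply: L_A0 => v /=.
  rewrite !beval_imps all_cat /=.
  by case: all; case: all; case: (beval v A); case: (beval v B).
Qed.

Lemma consistent_underivable G A : L_consistent G -> G A -> ~ deriv G (Neg A).
Proof.
move=> consG GA /deriv_finite[s [Gs sNA]]; apply: consG.
exists A, s; split; first by constructor.
apply: L_R1 sNA _; apply: L_A0 => v /=.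
by rewrite beval_imps beval_conj /=; case: (beval v A); case: all.
Qed.

(** The three clauses say that membership in [w] is a Boolean homomorphism to
    [Prop] sending theorems to truth; closure under modus ponens and maximality
    follow. *)
Definition is_world (w : set sentence) :=
  [/\ @theoremL Ag Var `<=` w,
      forall A, w (Neg A) <-> ~ w A &
      forall A B, w (And A B) <-> w A /\ w B].

(** A derivation uses finitely many hypotheses, hence only one member of a
    chain; the chain is nonempty so that theorems have a member to live in. *)
Lemma deriv_bigcup (F : set (set sentence)) A :
    F !=set0 -> total_on F subset -> deriv (\bigcup_(X in F) X) A ->
  exists2 X, F X & deriv X A.
Proof.
move=> [X0 FX0] Ftot; elim=> {A} [A [X FX XA]|A tA|].
- by exists X => //; exact: deriv_hyp.
- by exists X0 => //; exact: deriv_thm.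
- move=> A B _ [X FX dA] _ [Y FY dAB].
  have [XY|YX] := Ftot _ _ FX FY.
  + by exists Y => //; apply: deriv_mp dAB; exact: deriv_sub dA.
  + by exists X => //; apply: deriv_mp dA _; exact: deriv_sub dAB.
Qed.

(** A set that is maximal among those from which [A] is not derivable is
    complete: if neither [B] nor its negation were derivable, adding either one
    would make [A] derivable, and then [A] would follow by cases. *)
Lemma Lindenbaum G A : ~ deriv G A ->
  exists w, [/\ is_world w, G `<=` w & ~ w A].
Proof.
(* [G] is adjoined by [ext], not required to be included, so that the empty
   chain is harmless. *)
move=> GnA; pose ext (X : set sentence) := G `|` X.
have [F FP Ftot|D [DnA Dmax]] :=
    @Zorn_bigcup _ (fun X => ~ deriv (ext X) A).
  have [F0|/set0P F0] := eqVneq F set0.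
    by rewrite F0 bigcup_set0 /ext setU0.
  have -> : ext (\bigcup_(X in F) X) = \bigcup_(Y in ext @` F) Y.
    by rewrite bigcup_image /ext bigcupUr.
  move=> /deriv_bigcup[||_ [X FX <-] /(FP X FX)//].
    by case: F0 => X FX; exists (ext X), X.
  move=> _ _ [X FX <-] [Y FY <-].
  by have [XY|YX] := Ftot _ _ FX FY; [left|right]; exact: setUS.
have Dimp B : ~ deriv (ext D) B -> deriv (ext D) (Imp B A).
  move=> DnB; apply: deduction; apply: contrapT.
  rewrite /ext setUCA; apply: Dmax; split; first exact: subsetUr.
  by move=> /(_ B (or_introl erefl)) DB; apply/DnB/deriv_hyp; right.
exists (deriv (ext D)); split=> //; last by move=> B GB; apply: deriv_hyp; left.
split=> [B tB|B|B C]; first exact: deriv_thm.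
- split=> [dNB dB|/Dimp dBA].
    apply: DnA; apply: deriv_taut2 dNB dB => v /=.
    by case: (beval v B); case: (beval v A).
  apply: contrapT => /Dimp dNBA.
  apply: DnA; apply: deriv_taut2 dBA dNBA => v /=.
  by case: (beval v B); case: (beval v A).
- split=> [dBC|[dB dC]].
    by split; apply: deriv_taut dBC => v /=;
      case: (beval v B); case: (beval v C).
  apply: deriv_taut2 dB dC => v /=.
  by case: (beval v B); case: (beval v C).
Qed.

End Derivations.

(** * Worlds and their modal structure *)

Section Worlds.
Variables (Ag : finType) (Var : Type).
Local Notation sentence := (sentence Ag Var).
Implicit Types (A B C : sentence) (a : Ag) (Box : sentence -> sentence).

Record world := World {
  world_mem :> sentence -> Prop;
  world_memP : is_world world_mem }.
Implicit Types (u v w : world).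

Lemma world_thm w A : theoremL A -> w A.
Proof. by case: w => w /= [wT _ _] /wT. Qed.

Lemma worldN w A : w (Neg A) <-> ~ w A.
Proof. by case: w => w /= [_ wN _]; exact: wN. Qed.

Lemma worldA w A B : w (And A B) <-> w A /\ w B.
Proof. by case: w => w /= [_ _ wA]; exact: wA. Qed.

Lemma world_imp w A B : w (Imp A B) <-> (w A -> w B).
Proof.
rewrite /Imp worldN worldA worldN; split=> [nAB wA|AB [/AB wB /(_ wB)]//].
by apply: contrapT => nB; apply: nAB.
Qed.

Lemma world_mp w A B : theoremL (Imp A B) -> w A -> w B.
Proof. by move=> /(world_thm w)/world_imp. Qed.

(** Conjunctions indexed by a list are the form in which A4 is stated; the
    index set is the set of agents below. *)
Lemma world_conj w (I : eqType) (D : I -> sentence) i s :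
  w (conj_from (D i) [seq D j | j <- s]) <->
  forall j, j \in i :: s -> w (D j).
Proof.
elim: s i => [|j s IHs] i /=.
  by split=> [wi j|]; [rewrite inE => /eqP->|apply; rewrite mem_head].
rewrite worldA IHs; split=> [[wi ws] k|ws].
  by rewrite in_cons => /predU1P[->|/ws].
split=> [|k sk]; first by apply: ws; rewrite mem_head.
by apply: ws; rewrite in_cons sk orbT.
Qed.

Lemma world_complete G A : (forall w, G `<=` world_mem w -> w A) -> deriv G A.
Proof.
move=> GA; apply: contrapT => /Lindenbaum[w [ww Gw]]; apply.
exact: (GA (World ww)).
Qed.

Lemma theorem_complete A : (forall w, w A) -> theoremL A.
Proof. by move=> wA; apply/deriv_set0/world_complete. Qed.

(** For an S5 operator, equality of boxed contents is the canonical
    accessibility relation ([boxed_eq]), which is thereby presented as the kernel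
    of a map. *)
Definition boxed Box w : set sentence := [set A | w (Box A)].

Definition moment_of w := boxed (@Settled Ag Var) w.
Definition choice_of a w := boxed (Cstit a) w.

Section Box.
Variable Box : sentence -> sentence.
Hypothesis Box_S5 : S5_axiom Box `<=` @theoremL Ag Var.
Hypothesis Box_nec : forall A, theoremL A -> theoremL (Box A).

Lemma boxed_sub w : boxed Box w `<=` world_mem w.
Proof. by move=> A; apply: world_mp; apply/Box_S5/S5_T. Qed.

(** Axiom 4 carries boxed sentences from [w] to [u], and axiom 5 carries the
    negations of boxed sentences, which gives the converse inclusion. *)
Lemma boxed_eq w u : boxed Box w `<=` world_mem u -> boxed Box u = boxed Box w.
Proof.
move=> wu; apply/seteqP; split=> A.
  move=> uA; apply: contrapT => /worldN wNA.
  suff /worldN : u (Neg (Box A)) by apply.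
  by apply: wu; apply: world_mp wNA; apply/Box_S5/S5_5.
by move=> wA; apply: wu; apply: world_mp wA; apply/Box_S5/S5_4.
Qed.

(** Hypotheses, theorems and modus ponens are all preserved under prefixing
    [Box], respectively by assumption, by necessitation and by axiom K. *)
Lemma deriv_boxed w A : deriv (boxed Box w) A -> w (Box A).
Proof.
elim=> {A} [//|A tA|A B _ wA _ wAB]; first exact/world_thm/Box_nec.
by move: wAB wA => /(world_mp (Box_S5 (S5_K _ _ _)))/world_imp.
Qed.

Lemma world_box w A :
  w (Box A) <-> forall u, boxed Box u = boxed Box w -> u A.
Proof.
split=> [wA u uw|wA]; first by apply: boxed_sub; rewrite uw.
by apply/deriv_boxed/world_complete => u /boxed_eq; exact: wA.
Qed.

End Box.

Lemma world_settled w A :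
  w (Settled A) <->
  forall u, moment_of u = moment_of w -> u A.
Proof. by apply: world_box; [exact: L_A1|exact: L_R2]. Qed.

Lemma world_cstit w a A :
  w (Cstit a A) <-> forall u, choice_of a u = choice_of a w -> u A.
Proof.
apply: world_box => [B|B tB]; first exact: L_A2.
by apply: L_R1 (L_A3 _ _); exact: L_R2.
Qed.

Lemma world_cstit_and w a A B :
  w (Cstit a (And A B)) <-> w (Cstit a A) /\ w (Cstit a B).
Proof.
rewrite !world_cstit; split=> [wAB|[wA wB] u uw]; last first.
  by apply/worldA; split; [exact: wA|exact: wB].
by split=> u /wAB/worldA[].
Qed.

Lemma world_cstit_imp w a A : w (Cstit a (Imp A A)).
Proof. by apply/world_cstit => u _; exact/world_imp. Qed.

Lemma world_poss w A :
  w (Poss A) <->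
  exists2 u, moment_of u = moment_of w & u A.
Proof.
rewrite /Poss worldN world_settled; split=> [nwA|[u uw uA] /(_ u uw)/worldN//].
apply: contrapT => nu; apply: nwA => u uw.
by apply/worldN => uA; apply: nu; exists u.
Qed.

(** By A3 the settled sentences of [w] are among those that any agent
    realizes. *)
Lemma moment_of_choice_of a w u :
  choice_of a u = choice_of a w -> moment_of u = moment_of w.
Proof.
move=> uw; apply: boxed_eq; first exact: L_A1.
move=> A /(world_mp (L_A3 a A)) wA.
suff : choice_of a u A by apply: boxed_sub; exact: L_A2.
by rewrite uw.
Qed.

(** This is A4 for all agents at once, read in terms of worlds. *)
Lemma compatible_actions w (u : Ag -> world) (F : Ag -> sentence) :
    (forall a, moment_of (u a) = moment_of w) ->
    (forall a, u a (Cstit a (F a))) ->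
  exists2 v, moment_of v = moment_of w &
    forall a, v (Cstit a (F a)).
Proof.
move=> uw uF; case Ags: (enum Ag) => [|b s].
  by exists w => // a; have := mem_enum Ag a; rewrite Ags.
pose D a := Cstit a (F a).
have mem_bs a : a \in b :: s by rewrite -Ags mem_enum.
have uniq_bs : uniq [seq y.1 | y <- (b, F b) :: [seq (a, F a) | a <- s]].
  by rewrite -(map_cons (fun a => (a, F a))) -map_comp map_id -Ags enum_uniq.
have := L_A4 uniq_bs; rewrite -!map_comp => /(world_mp (w := w)).
case/(_ _)/world_poss.
  apply/(world_conj w (fun a => Poss (D a))) => a _.
  by apply/world_poss; exists (u a).
by move=> v vw /(world_conj v D) vD; exists v => // a; apply: vD.
Qed.

(** The world [v] must contain the union of the boxed contents of the [u a],
    together with the settled sentences of [w].  A sentence derivable from that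
    union already follows from one cstit sentence per agent, because [[c]_a]
    commutes with conjunction; [compatible_actions] realizes these sentences in
    a world, so no contradiction is derivable. *)
Lemma independence w (u : Ag -> world) :
    (forall a, moment_of (u a) = moment_of w) ->
  exists2 v, moment_of v = moment_of w &
    forall a, choice_of a v = choice_of a (u a).
Proof.
move=> uw; have [[A _]|noA] := pselect (exists A : sentence, True); last first.
  by exists w => // a; apply/seteqP; split=> A; case: noA; exists A.
pose G := moment_of w `|` [set A | exists a, u a (Cstit a A)].
have GF B : deriv G B -> exists F : Ag -> sentence,
    (forall a, u a (Cstit a (F a))) /\
    forall v, moment_of v = moment_of w ->
      (forall a, v (Cstit a (F a))) -> v B.
  (* [Imp A A] serves as the trivially true action of an idle agent. *)
  elim=> {B} [B [wB|[a uB]]|B tB|B C _ [F [uF FB]] _ [F' [uF' FBC]]].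
  - exists (fun=> Imp A A); split=> [a|v vw _]; first exact: world_cstit_imp.
    by apply: (boxed_sub (@L_A1 Ag Var)); rewrite -/(moment_of v) vw.
  - exists (fun b => if b == a then B else Imp A A).
    split=> [b|v _ /(_ a)]; last by rewrite eqxx; apply: boxed_sub; exact: L_A2.
    by case: eqP => [->//|_]; exact: world_cstit_imp.
  - exists (fun=> Imp A A); split=> [a|v _ _]; last exact: world_thm.
    exact: world_cstit_imp.
  - exists (fun a => And (F a) (F' a)).
    split=> [a|v vw vF]; first exact/world_cstit_and.
    have /world_imp : v (Imp B C).
      by apply: FBC => // a; have /world_cstit_and[] := vF a.
    by apply; apply: FB => // a; have /world_cstit_and[] := vF a.
have : ~ deriv G (Neg (Imp A A)).
  move=> /GF[F [uF GN]]; have [v vw vF] := compatible_actions uw uF.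
  by have /worldN := GN v vw vF; apply; apply/world_imp.
move=> /Lindenbaum[v [wv Gv _]]; exists (World wv).
  by apply: boxed_eq => [B|B wB]; [exact: L_A1|apply: Gv; left].
move=> a; apply: boxed_eq => [B|B uB]; first exact: L_A2.
by apply: Gv; right; exists a.
Qed.

End Worlds.

(** * A tree of height three *)

Section Fan.
Variables (W K : Type) (cls : W -> K).

(** [Node k] is a moment for the [cls]-class with value [k].  Values that [cls]
    does not take are allowed; such a node is a maximal element whose only
    history has no leaf. *)
Inductive fan := Root | Node of K | Leaf of W.

Definition fan_le (m n : fan) : Prop :=
  match m, n with
  | Root, _ => True
  | Node k, Node l => k = l
  | Node k, Leaf w => k = cls w
  | Leaf w, Leaf u => w = u
  | _, _ => False
  end.

Definition branch w : set fan := [set m | fan_le m (Leaf w)].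

Lemma fan_le_refl m : fan_le m m.
Proof. by case: m. Qed.

Lemma fan_le_antisym m n : fan_le m n -> fan_le n m -> m = n.
Proof. by case: m n => [|k|w] [|l|u] //= ->. Qed.

Lemma fan_le_trans m n p : fan_le m n -> fan_le n p -> fan_le m p.
Proof. by case: m n p => [|k|w] [|l|u] [|j|v] //= -> ->. Qed.

Lemma fan_le_connected m n : exists p, fan_le p m /\ fan_le p n.
Proof. by exists Root. Qed.

Lemma fan_no_backward_branching m n p :
  fan_le m p -> fan_le n p -> fan_le m n \/ fan_le n m.
Proof.
by case: m n p => [|k|w] [|l|u] [|j|v] //=; try (move=> -> ->); by [left|right].
Qed.

Lemma history_branch w : history fan_le (branch w).
Proof.
split=> [m n mw nw|h htot wh]; first exact: fan_no_backward_branching mw nw.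
apply/seteqP; split=> // m hm.
have [//|] := htot _ _ hm (wh (Leaf w) erefl).
by case: m hm => //= u _ ->.
Qed.

Lemma history_leaf h w : history fan_le h -> h (Leaf w) -> h = branch w.
Proof.
move=> [htot hmax] hw; have [wtot _] := history_branch w.
suff hsub : h `<=` branch w by rewrite -(hmax _ wtot hsub).
move=> m hm; have [//|] := htot _ _ hm hw.
by case: m hm => //= u _ ->.
Qed.

(** A chain through [Node (cls w)] without a leaf is contained in [branch w],
    hence is not maximal. *)
Lemma histories_at_node w h :
  histories_at fan_le (Node (cls w)) h ->
  exists2 u, cls u = cls w & h = branch u.
Proof.
move=> [hh hw].
have [[u hu]|nleaf] := pselect (exists u, h (Leaf u)).
  exists u; last exact: history_leaf.
  by move: hw; rewrite (history_leaf hh hu).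
exists w => //; case: (hh) => htot hmax.
have [wtot _] := history_branch w.
rewrite -(hmax _ wtot) // => m hm.
have := htot _ _ hm hw; case: m hm => [|k|u] //= hm; first by case.
by case: nleaf; exists u.
Qed.

Lemma branch_at_node w u :
  cls u = cls w -> histories_at fan_le (Node (cls w)) (branch u).
Proof. by move=> uw; split; [exact: history_branch|rewrite /branch /= uw]. Qed.

(** * The imagination model on the tree *)

Section Model.
Variables (Ag : finType) (Var L : Type) (cell : Ag -> W -> L).
Variables (nbhd : Ag -> W -> set (set W)) (val : Var -> set W).
Hypothesis independent : forall w (u : Ag -> W),
  (forall a, cls (u a) = cls w) ->
  exists2 v, cls v = cls w & forall a, cell a v = cell a (u a).

(** The choice cells at [m] are the fibres of [label m a].  At a node, a history
    is labelled by the [cell] of its leaf, taken as a set since a history need not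
    have a leaf in general; at the root and the leaves the label is constant, so
    the choice there is vacuous. *)
Definition label (m : fan) (a : Ag) (h : set fan) : set L :=
  if m is Node _ then [set cell a w | w in [set w | h (Leaf w)]] else set0.

Definition choice_at (m : fan) (a : Ag) (h : set fan) : set (set fan) :=
  [set h' | histories_at fan_le m h' /\ label m a h' = label m a h].

Definition fan_choice (m : fan) (a : Ag) : set (set (set fan)) :=
  choice_at m a @` histories_at fan_le m.

Lemma fan_choice_partition m a :
  partition (fan_choice m a) id (histories_at fan_le m).
Proof.
split=> [|_ _ [h hm <-] [h' hm' <-] [g [[gm gh] [_ gh']]]|_ [h hm <-]].
- apply/seteqP; split=> [g [_ [h hm <-] []]//|h hm].
  by exists (choice_at m a h) => //; exists h.
- by rewrite /choice_at -gh -gh'.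
- by exists h.
Qed.

Lemma label_branch k a w : label (Node k) a (branch w) = [set cell a w].
Proof.
apply/seteqP; split=> [_ [u /= -> <-]//|_ ->].
by exists w.
Qed.

(** Histories that share a moment above a node share a leaf, hence are equal. *)
Lemma fan_choice_undivided m a e h h' :
  fan_choice m a e -> histories_at fan_le m h -> histories_at fan_le m h' ->
  e h -> (exists m', (fan_le m m' /\ m <> m') /\ (h `&` h') m') -> e h'.
Proof.
move=> [g gm <-] [hh _] [hh' hm'] [_ hg] [m' [[mm' mNm'] [hm1 hm2]]].
split=> //; rewrite -hg.
case: m mm' mNm' {gm hg} hm' => //= k; case: m' hm1 hm2 => [//|l|w] hm1 hm2.
  by move=> ->.
by rewrite (history_leaf hh hm1) (history_leaf hh' hm2).
Qed.

Lemma fan_choice_independent m (f : Ag -> set (set fan)) :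
  (forall a, fan_choice m a (f a)) -> \bigcap_(a in [set: Ag]) f a !=set0.
Proof.
move=> fm; have /choice[g gP] : forall a, exists h,
    histories_at fan_le m h /\ choice_at m a h = f a.
  by move=> a; have [h hm hf] := fm a; exists h.
have [[w mw]|nw] := pselect (exists w, m = Node (cls w)).
  have /choice[u uP] : forall a, exists u, cls u = cls w /\ g a = branch u.
    move=> a; have [] := gP a; rewrite mw => /histories_at_node[u uw gu] _.
    by exists u.
  have [v vw vu] := independent (fun a => (uP a).1).
  exists (branch v) => a _; have [_ <-] := gP a; rewrite (uP a).2 mw.
  split; first exact: branch_at_node.
  by rewrite !label_branch vu.
(* At every other moment the labels are constant: there is one cell only. *)
have label0 a h : histories_at fan_le m h -> label m a h = set0.
  case: m nw {fm gP} => //= k nw [hh hk].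
  apply/seteqP; split=> // l [w hw _]; case: nw; exists w.
  by move: hk; rewrite (history_leaf hh hw) /branch /= => ->.
have [b _|noAg] := pickP (fun _ : Ag => true).
  exists (g b) => a _; have [ga <-] := gP a; have [gb _] := gP b.
  by split; rewrite ?label0.
by exists set0 => a; have := noAg a.
Qed.

(** A world [w] is represented by the moment [Node (cls w)] on [branch w]; no
    neighbourhoods are given elsewhere, and a set is tested only through its
    trace on the worlds, which is all that the truth lemma controls. *)
Definition fan_nbhd (a : Ag) (x : moment_history fan_le) :
    set (set (moment_history fan_le)) :=
  [set U | exists2 w, mh_moment x = Node (cls w) /\ mh_history x = branch w &
     nbhd a w [set u | U (MomentHistory (branch_at_node (erefl (cls u))))]].

Definition fan_val (p : Var) : set (moment_history fan_le) :=
  [set x | exists2 w, mh_moment x = Node (cls w) /\ mh_history x = branch w &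
     val p w].

Definition fan_model : imagination_model Ag Var :=
  @ImaginationModel Ag Var fan fan_le (ex_intro _ Root Logic.I) fan_le_refl
    fan_le_antisym fan_le_trans fan_le_connected fan_no_backward_branching
    fan_choice fan_choice_partition fan_choice_undivided fan_choice_independent
    fan_nbhd fan_val.

Definition point w : MH fan_model :=
  MomentHistory (branch_at_node (erefl (cls w))).

Lemma branch_inj w u : branch w = branch u -> w = u.
Proof. by move=> wu; have : branch u (Leaf w) by rewrite -wu. Qed.

(** Quantification over the histories through a node is quantification over the
    worlds of a class. *)
Lemma all_histories w (P : MH fan_model -> Prop) :
  (forall h (mh : histories_at fan_le (Node (cls w)) h), P (MomentHistory mh)) <->
  forall u, cls u = cls w -> P (point u).
Proof.
split=> [hP u uw|uP h mh].
  rewrite /point; move: (branch_at_node _); rewrite uw => mh; exact: hP.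
have [u uw hu] := histories_at_node mh.
have := uP u uw; rewrite /point; move: (branch_at_node _).
by move: mh; rewrite hu uw => mh mh'; rewrite (Prop_irrelevance mh' mh).
Qed.

Lemma cell_choice w u a : cls u = cls w ->
  @Choice_cell _ _ fan_model (Node (cls w)) a (branch w) (branch u) <->
  cell a u = cell a w.
Proof.
move=> uw; split=> [[_ [[h hm <-] [_ wh]] [_]]|aw].
  by rewrite -wh !label_branch => /seteqP[/(_ _ erefl)].
exists (choice_at (Node (cls w)) a (branch w)).
  split; [exists (branch w) => //|split=> //]; exact: branch_at_node.
split; first exact: branch_at_node.
by rewrite !label_branch aw.
Qed.

Lemma all_cell w a (P : MH fan_model -> Prop) :
  (forall h (mh : histories_at fan_le (Node (cls w)) h),
     @Choice_cell _ _ fan_model (Node (cls w)) a (branch w) h ->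
     P (MomentHistory mh)) <->
  forall u, cls u = cls w -> cell a u = cell a w -> P (point u).
Proof.
pose Q (x : MH fan_model) :=
  @Choice_cell _ _ fan_model (Node (cls w)) a (branch w) (mh_history x) -> P x.
rewrite (all_histories w Q); split=> PQ u uw; have Pu := PQ u uw;
  by move=> /(cell_choice a uw); exact: Pu.
Qed.

Lemma nbhd_point w a (U : set (MH fan_model)) :
  fan_nbhd a (point w) U <-> nbhd a w [set u | U (point u)].
Proof.
by split=> [[u [_ /branch_inj <-]]//|wU]; exists w.
Qed.

Lemma sat_atom p w : sat (Atom Ag p) (point w) <-> val p w.
Proof. by split=> [[u [_ /branch_inj <-]]//|pw]; exists w. Qed.

Lemma sat_settled A w : sat (Settled A) (point w) <->
  forall u, cls u = cls w -> sat A (point u).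
Proof. exact: (all_histories w (sat A)). Qed.

Lemma sat_cstit a A w : sat (Cstit a A) (point w) <->
  forall u, cls u = cls w -> cell a u = cell a w -> sat A (point u).
Proof. exact: (all_cell w a (sat A)). Qed.

Lemma sat_imag a A w : sat (Imag a A) (point w) <->
  (forall u, cls u = cls w -> cell a u = cell a w ->
     nbhd a u [set v | sat A (point v)]) /\
  exists2 u, cls u = cls w & ~ nbhd a u [set v | sat A (point v)].
Proof.
pose N := [set x : MH fan_model | Nbhd a x (@sat _ _ fan_model A)].
have -> : sat (Imag a A) (point w) <->
    (forall u, cls u = cls w -> cell a u = cell a w -> N (point u)) /\
    ~ forall u, cls u = cls w -> N (point u).
  rewrite -(all_cell w a N) -(all_histories w N).
  split=> -[Na Nw]; split=> //.
    by move=> all_N; case: Nw => h [mh]; apply; exact: all_N.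
  apply: contrapT => nN; apply: Nw => h mh; apply: contrapT => Nh.
  by apply: nN; exists h, mh.
split=> -[Na nN]; split=> [u uw ua|].
- by apply/nbhd_point; exact: Na.
- apply: contrapT => nu; apply: nN => u uw; apply/nbhd_point.
  by apply: contrapT => nuA; apply: nu; exists u.
- by apply/nbhd_point; exact: Na.
- by move=> all_N; case: nN => u uw; apply; apply/nbhd_point; exact: all_N.
Qed.

End Model.
End Fan.

(** * The canonical model *)

Section Canonical.
Variables (Ag : finType) (Var : Type).
Local Notation world := (world Ag Var).

Definition imagined (a : Ag) (w : world) : set (set world) :=
  [set U | exists2 A, w (Imag a A) & U = [set u : world | u A]].

(** Two sentences contained in the same worlds are provably equivalent, so R3
    makes them interchangeable under [I_a]. *)
Lemma imagined_truth_set a (w : world) A :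
  imagined a w [set u : world | u A] <-> w (Imag a A).
Proof.
split=> [[B wB AB]|wA]; last by exists A.
suff /(L_R3 a)/(world_thm w)/worldA[_ /world_imp] : theoremL (Iff A B) by apply.
apply: theorem_complete => u.
have uAB : u A = u B by have := congr1 (fun U : set world => U u) AB.
by apply/worldA; split; apply/world_imp; rewrite uAB.
Qed.

Definition canonical_model : imagination_model Ag Var :=
  fan_model imagined (fun p => [set w : world | w (Atom Ag p)])
    (@independence Ag Var).

Definition canonical_point (w : world) : MH canonical_model :=
  point imagined (fun p => [set w : world | w (Atom Ag p)])
    (@independence Ag Var) w.

Lemma truth (A : sentence Ag Var) (w : world) :
  sat A (canonical_point w) <-> w A.
Proof.
elim: A w => [p|A IHA|A IHA B IHB|A IHA|a A IHA|a A IHA] w.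
- exact: sat_atom.
- by rewrite worldN -IHA.
- by rewrite worldA -IHA -IHB.
- rewrite world_settled sat_settled.
  by split=> wA u uw; apply/IHA; exact: wA.
- rewrite world_cstit sat_cstit; split=> wA u.
    by move=> uw; apply/IHA; apply: wA => //; exact: moment_of_choice_of uw.
  by move=> _ uw; apply/IHA; exact: wA.
(* By induction the neighbourhood test for the truth set of [A] is membership of
   [Imag a A]; A5 then matches the two conjuncts. *)
have -> : sat (Imag a A) (canonical_point w) <->
    (forall u, moment_of u = moment_of w ->
      choice_of a u = choice_of a w -> u (Imag a A)) /\
    exists2 u, moment_of u = moment_of w & ~ u (Imag a A).
  have truthA : [set v | sat A (canonical_point v)] = [set v : world | v A].
    by apply/seteqP; split=> v /IHA.
  rewrite sat_imag -/canonical_point truthA.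
  split=> -[wA [u uw unA]];
    (split=> [v vw va|]; first by apply/imagined_truth_set; exact: wA);
    by exists u => // /imagined_truth_set.
split=> [[wA _]|/(world_mp (L_A5 a A))/worldA[cwA /worldN nSA]]; first exact: wA.
split=> [u _|]; first by move/world_cstit: cwA; exact.
apply: contrapT => nu; apply: nSA; apply/world_settled => u uw.
by apply: contrapT => unA; apply: nu; exists u.
Qed.

End Canonical.

Theorem theorem1 (Ag : finType) (Var : Type)
    (hVar : [set: Var] #= [set: nat])
    (Theta : set (sentence Ag Var)) (hTheta : L_consistent Theta) :
  exists (M : imagination_model Ag Var) (m : M) (h : set M)
         (mh : histories_at (@tree_le _ _ M) m h),
    forall A : sentence Ag Var, Theta A -> sat A (MomentHistory mh).
Proof.
have [[C ThetaC]|Theta0] := pselect (exists C, Theta C); last first.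
  (* The empty set holds in every model, in particular on the tree of a single
     world. *)
  have indep (w : unit) (u : Ag -> unit) : (forall a, id (u a) = id w) ->
      exists2 v, id v = id w & forall a, id v = id (u a).
    by move=> uw; exists w.
  pose M := fan_model (fun _ _ => set0) (fun _ : Var => set0) indep.
  exists M, (Node _ tt), (branch id tt), (branch_at_node (erefl tt)).
  by move=> A ThetaA; case: Theta0; exists A.
have [w [ww Thetaw _]] := Lindenbaum (consistent_underivable hTheta ThetaC).
exists (canonical_model Ag Var), _, _, (mh_passes (canonical_point (World ww))).
by move=> A /Thetaw wA; apply/(truth A (World ww)).
Qed.
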